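(* Two hyperbolic cusps of maximal rank (of the same dimension $n$) are projectively equivalent if and only if their holonomies are conjugate in $PO(n,1)$. That is: suppose $\Gamma_1,\Gamma_2\subset PO(n,1)$ are two groups of parabolic isometries such that the quotients $C_i=\mathbb{H}^n/\Gamma_i$ are maximal rank cusps. Then $\Gamma_1$ and $\Gamma_2$ are conjugate subgroups of $PGL(n+1,\mathbb{R})$ if and only if they are conjugate subgroups of $PO(n,1)$.
   Context: $\mathbb{H}^n$ is the projective (Klein) model of hyperbolic space: the round ball in $\mathbb{RP}^n$ preserved by $PO(n,1)\subset PGL(n+1,\mathbb{R})$. Each $\Gamma_i$ is an infinite discrete torsion-free group of parabolic isometries of $\mathbb{H}^n$, all fixing a common point $p_i\in\partial\overline{\mathbb{H}^n}$; $\Gamma_i$ is the holonomy of the cusp $\mathbb{H}^n/\Gamma_i$. The cusp has maximal rank if $\Gamma_i$ acts cocompactly on the horospheres centered at $p_i$ (equivalently on $\partial\overline{\mathbb{H}^n}\setminus\{p_i\}$). Two cusps are projectively equivalent if their holonomies are conjugate in $PGL(n+1,\mathbb{R})$. *)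

(* Defs.v *)
From HB Require Import structures.
From mathcomp Require Import all_boot all_order all_algebra.
From mathcomp Require Import all_classical all_reals all_analysis.

Set Implicit Arguments.
Unset Strict Implicit.
Unset Printing Implicit Defensive.

Import Order.TTheory GRing.Theory Num.Theory.
Import numFieldNormedType.Exports.

Local Open Scope classical_set_scope.
Local Open Scope quotient_scope.
Local Open Scope ring_scope.

Section GeneralLinear.
Context {R : realType} {n : nat}.

(* GL(n+1, R), with the topology induced by that of the matrices; n is the
   dimension of the hyperbolic space, so matrices have size n.+1. *)
Record GL := MkGL { GLmx :> 'M[R]_n.+1; GLmx_unit : GLmx \in unitmx }.
HB.instance Definition _ := [isSub for GLmx].
HB.instance Definition _ := [Choice of GL by <:].
HB.instance Definition _ := Topological.copy GL (initial_topology GLmx).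

Definition GLone : GL := MkGL (unitmx1 R n.+1).

Lemma GLmul_subproof (A B : GL) : A *m B \in unitmx.
Proof. by rewrite unitmx_mul !GLmx_unit. Qed.
Definition GLmul (A B : GL) : GL := MkGL (GLmul_subproof A B).

Lemma GLinv_subproof (A : GL) : invmx A \in unitmx.
Proof. by rewrite unitmx_inv GLmx_unit. Qed.
Definition GLinv (A : GL) : GL := MkGL (GLinv_subproof A).

Lemma GLmulA : associative GLmul.
Proof. by move=> A B C; apply: val_inj => /=; rewrite mulmxA. Qed.
Lemma GLmul1l : left_id GLone GLmul.
Proof. by move=> A; apply: val_inj => /=; rewrite mul1mx. Qed.
Lemma GLmul1r : right_id GLone GLmul.
Proof. by move=> A; apply: val_inj => /=; rewrite mulmx1. Qed.
Lemma GLmulVl : left_inverse GLone GLinv GLmul.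
Proof. by move=> A; apply: val_inj => /=; rewrite mulVmx ?GLmx_unit. Qed.
Lemma GLmulVr : right_inverse GLone GLinv GLmul.
Proof. by move=> A; apply: val_inj => /=; rewrite mulmxV ?GLmx_unit. Qed.
HB.instance Definition _ :=
  isGroup.Build GL GLmulA GLmul1l GLmul1r GLmulVl GLmulVr.

(* The punctured space R^(n+1) \ {0}, of column vectors *)
Record nzvec := MkNzvec { vec :> 'cV[R]_n.+1; vec_neq0 : vec != 0 }.
HB.instance Definition _ := [isSub for vec].
HB.instance Definition _ := [Choice of nzvec by <:].
HB.instance Definition _ := Topological.copy nzvec (initial_topology vec).

Lemma GLact_subproof (A : GL) (v : nzvec) : A *m v != 0.
Proof.
apply: contra (vec_neq0 v) => /eqP Av0.
by rewrite -(mulKmx (GLmx_unit A) v) Av0 mulmx0.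
Qed.
Definition GLact (A : GL) (v : nzvec) : nzvec := MkNzvec (GLact_subproof A v).

End GeneralLinear.
Arguments GL : clear implicits.
Arguments nzvec : clear implicits.

Section Proportional.
Context {R : realType} {p q : nat} {T : Type} (f : T -> 'M[R]_(p, q)).

Definition proportional (x y : T) : bool :=
  `[< exists2 c : R, c != 0 & f x = c *: f y >].

Lemma proportional_refl : reflexive proportional.
Proof. by move=> x; apply/asboolP; exists 1; rewrite ?oner_eq0 ?scale1r. Qed.

Lemma proportional_sym : symmetric proportional.
Proof.
suff sub x y : proportional x y -> proportional y x.
  by move=> x y; apply/idP/idP; exact: sub.
move=> /asboolP[c c0 fxy]; apply/asboolP; exists c^-1; rewrite ?invr_eq0//.
by rewrite fxy scalerA mulVf ?scale1r.
Qed.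

Lemma proportional_trans : transitive proportional.
Proof.
move=> y x z /asboolP[c c0 fxy] /asboolP[d d0 fyz]; apply/asboolP.
by exists (c * d); rewrite ?mulf_neq0 // fxy fyz scalerA.
Qed.

End Proportional.

Section Projective.
Context {R : realType} {n : nat}.

Definition GL_equiv := EquivRel (proportional (@GLmx R n))
  (proportional_refl (@GLmx R n)) (proportional_sym (@GLmx R n))
  (@proportional_trans _ _ _ _ (@GLmx R n)).

Definition nzvec_equiv := EquivRel (proportional (@vec R n))
  (proportional_refl (@vec R n)) (proportional_sym (@vec R n))
  (@proportional_trans _ _ _ _ (@vec R n)).

(* PGL(n+1, R) and RP^n, with the quotient topologies *)
Definition PGL : Type := quotient_topology {eq_quot GL_equiv}.
HB.instance Definition _ := Choice.on PGL.
HB.instance Definition _ := Quotient.copy PGL {eq_quot GL_equiv}.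
HB.instance Definition _ := Topological.on PGL.

Definition RP : Type := quotient_topology {eq_quot nzvec_equiv}.
HB.instance Definition _ := Choice.on RP.
HB.instance Definition _ := Quotient.copy RP {eq_quot nzvec_equiv}.
HB.instance Definition _ := Topological.on RP.

Lemma PGL_eqP (A B : GL R n) :
  \pi_PGL A = \pi_PGL B <->
  exists2 c : R, c != 0 & GLmx A = c *: GLmx B.
Proof.
split=> [/(@eqquotP _ GL_equiv)/asboolP //|AB].
by apply/(@eqquotP _ GL_equiv)/asboolP.
Qed.

Lemma RP_eqP (v w : nzvec R n) :
  \pi_RP v = \pi_RP w <->
  exists2 c : R, c != 0 & vec v = c *: vec w.
Proof.
split=> [/(@eqquotP _ nzvec_equiv)/asboolP //|vw].
by apply/(@eqquotP _ nzvec_equiv)/asboolP.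
Qed.

Definition PGLone : PGL := \pi_PGL (1%g : GL R n).
Definition PGLmul (g h : PGL) : PGL := \pi_PGL (repr g * repr h)%g.
Definition PGLinv (g : PGL) : PGL := \pi_PGL (repr g)^-1%g.
Definition PGLact (g : PGL) (x : RP) : RP := \pi_RP (GLact (repr g) (repr x)).

Lemma PGLmul_pi (A B : GL R n) :
  PGLmul (\pi_PGL A) (\pi_PGL B) = \pi_PGL (A * B)%g.
Proof.
rewrite /PGLmul; apply/PGL_eqP.
have /PGL_eqP[c c0 /= ->] : \pi_PGL (repr (\pi_PGL A)) = \pi_PGL A.
  by rewrite reprK.
have /PGL_eqP[d d0 /= ->] : \pi_PGL (repr (\pi_PGL B)) = \pi_PGL B.
  by rewrite reprK.
by exists (c * d); rewrite ?mulf_neq0 // -scalemxAl -scalemxAr scalerA.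
Qed.

Lemma PGLinv_pi (A : GL R n) : PGLinv (\pi_PGL A) = \pi_PGL (A^-1)%g.
Proof.
rewrite /PGLinv; apply/PGL_eqP.
have /PGL_eqP[c c0 /= ->] : \pi_PGL (repr (\pi_PGL A)) = \pi_PGL A.
  by rewrite reprK.
exists c^-1; rewrite ?invr_eq0 // invmxZ //.
by rewrite unitmxZ ?unitfE // GLmx_unit.
Qed.

Lemma PGLact_pi (A : GL R n) (v : nzvec R n) :
  PGLact (\pi_PGL A) (\pi_RP v) = \pi_RP (GLact A v).
Proof.
rewrite /PGLact; apply/RP_eqP.
have /PGL_eqP[c c0 /= ->] : \pi_PGL (repr (\pi_PGL A)) = \pi_PGL A.
  by rewrite reprK.
have /RP_eqP[d d0 /= ->] : \pi_RP (repr (\pi_RP v)) = \pi_RP v.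
  by rewrite reprK.
by exists (c * d); rewrite ?mulf_neq0 // -scalemxAl -scalemxAr scalerA.
Qed.

Lemma PGLmulA : associative PGLmul.
Proof.
move=> x y z; elim/quotW: x => A; elim/quotW: y => B; elim/quotW: z => C.
by rewrite (PGLmul_pi B C) (PGLmul_pi A B) !PGLmul_pi mulgA.
Qed.
Lemma PGLmul1l : left_id PGLone PGLmul.
Proof. by move=> x; elim/quotW: x => A; rewrite PGLmul_pi mul1g. Qed.
Lemma PGLmul1r : right_id PGLone PGLmul.
Proof. by move=> x; elim/quotW: x => A; rewrite PGLmul_pi mulg1. Qed.
Lemma PGLmulVl : left_inverse PGLone PGLinv PGLmul.
Proof. by move=> x; elim/quotW: x => A; rewrite PGLinv_pi PGLmul_pi mulVg. Qed.
Lemma PGLmulVr : right_inverse PGLone PGLinv PGLmul.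
Proof. by move=> x; elim/quotW: x => A; rewrite PGLinv_pi PGLmul_pi mulgV. Qed.
HB.instance Definition _ :=
  isGroup.Build PGL PGLmulA PGLmul1l PGLmul1r PGLmulVl PGLmulVr.

End Projective.
Arguments PGL : clear implicits.
Arguments RP : clear implicits.

Section Hyperbolic.
Context {R : realType} {n : nat}.

(* The matrix diag(1, ..., 1, -1) and its form x_0^2 + ... + x_(n-1)^2 - x_n^2 *)
Definition lorentz : 'M[R]_n.+1 :=
  diag_mx (\row_i (if i == ord_max then -1 else 1)).

Definition lorentz_form (v : 'cV[R]_n.+1) : R := (v^T *m lorentz *m v) 0 0.

(* PO(n, 1), as a subgroup of PGL(n+1, R) *)
Definition PO : set (PGL R n) :=
  [set \pi_(PGL R n) A | A in
    [set A : GL R n | (GLmx A)^T *m lorentz *m A = lorentz]].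

(* The round ball of RP^n (the unit ball of the affine chart x_n = 1) and its
   boundary sphere *)
Definition hyp : set (RP R n) :=
  [set \pi_(RP R n) v | v in [set v : nzvec R n | lorentz_form v < 0]].

Definition hyp_boundary : set (RP R n) :=
  [set \pi_(RP R n) v | v in [set v : nzvec R n | lorentz_form v = 0]].

Definition parabolic (g : PGL R n) : Prop :=
  (forall x, hyp x -> PGLact g x <> x) /\
  (exists! x, hyp_boundary x /\ PGLact g x = x).

Definition torsion_free (G : set (PGL R n)) : Prop :=
  forall g k, G g -> (0 < k)%N -> (g ^+ k = 1)%g -> g = 1%g.

Definition discrete_set (G : set (PGL R n)) : Prop := G `<=` isolated G.

Definition cocompact_on (G : set (PGL R n)) (X : set (RP R n)) : Prop :=
  exists K : set (RP R n), [/\ compact K, K `<=` X &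
    X `<=` \bigcup_(g in G) (PGLact g @` K)].

(* G is the holonomy of a hyperbolic cusp with parabolic fixed point p *)
Definition cusp_holonomy (G : set (PGL R n)) (p : RP R n) : Prop :=
  [/\ [/\ group_closed [in G], G `<=` PO & infinite_set G],
      discrete_set G, torsion_free G,
      (forall g, G g -> g != 1%g -> parabolic g) &
      hyp_boundary p /\ (forall g, G g -> PGLact g p = p)].

(* Cocompactness is expressed on the boundary minus p, which is equivariantly
   homeomorphic to every horosphere centered at p. *)
Definition maximal_rank (G : set (PGL R n)) (p : RP R n) : Prop :=
  cocompact_on G (hyp_boundary `\ p).

Definition conjugate_in (P G H : set (PGL R n)) : Prop :=
  exists2 g, P g & [set (x ^ g)%g | x in G] = H.

End Hyperbolic.
Arguments PO : clear implicits.

(* Main.v *)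
(* Let e span p1, let J be the Lorentz form and let S be the pullback of J by
   the inverse of the conjugating matrix. Gamma1 preserves S, so the function
   S(w,w) / J(e,w)^2 on the boundary minus p1 is Gamma1-invariant, hence bounded
   by cocompactness. Along any parabola of the light cone through p1 it is a
   polynomial, hence constant; comparing coefficients gives
   S(w,w) = a J(w,w) + c J(e,w)^2. The shear w |-> w + c/(2a) J(e,w) e commutes
   with Gamma1, because parabolics have eigenvalue 1 or -1 on e, and it pulls J
   back to S/a; precomposing the conjugating matrix with it gives a matrix that
   scales J by a positive factor, that is, an element of PO(n,1). *)
Require Import Defs.
From mathcomp Require Import all_boot all_order all_algebra.
From mathcomp Require Import all_classical all_reals all_analysis.
From mathcomp Require Import ring lra.

Set Implicit Arguments.
Unset Strict Implicit.
Unset Printing Implicit Defensive.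

Import Order.TTheory GRing.Theory Num.Theory.
Import numFieldNormedType.Exports.

Local Open Scope ring_scope.
Local Open Scope quotient_scope.
Local Open Scope classical_set_scope.

(** Write [p] as [q X + c]: the bound on [p] bounds [q(t) t], hence [q(t)] for [t >= 1], so [q] is
    constant by induction, and then zero. *)
Lemma bounded_poly_const (R : realFieldType) (p : {poly R}) (m : R) :
  (forall t, 1 <= t -> `|p.[t]| <= m) -> p = (p`_0)%:P.
Proof.
elim/poly_ind: p m => [|p c IHp] m pm; first by rewrite coef0.
have m_ge0 : 0 <= m by exact: le_trans (normr_ge0 _) (pm 1 (lexx 1)).
have pXm t : 1 <= t -> `|p.[t] * t| <= m + `|c|.
  move=> t1; have := pm _ t1; rewrite !hornerE => ptc.
  rewrite -[p.[t] * t](addrK c); apply: le_trans (ler_normB _ _) _.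
  by rewrite lerD2r.
have pE : p = (p`_0)%:P.
  apply: (IHp (m + `|c|)) => t t1; apply: le_trans (pXm t t1).
  by rewrite normrM ler_peMr // (le_trans t1) // ler_norm.
suff -> : p = 0 by rewrite mul0r add0r coefC.
rewrite pE; apply/eqP; rewrite polyC_eq0; apply: contraT => p0.
set d := `|p`_0|; have d_gt0 : 0 < d by rewrite normr_gt0.
have mc : 0 <= (m + `|c|) / d by rewrite divr_ge0 ?addr_ge0 // ltW.
have /pXm : 1 <= (m + `|c|) / d + 1 by rewrite lerDr.
rewrite pE hornerC normrM -/d ger0_norm; last by rewrite addr_ge0.
by rewrite mulrDr mulr1 mulrC divfK ?gt_eqF // gerDl leNgt d_gt0.
Qed.

(** * Bilinear forms given by matrices *)

Section BilinearForm.
Context {R : comNzRingType} {n : nat}.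
Implicit Types (A : 'M[R]_n) (u v w : 'cV[R]_n).

Definition bil A u v : R := (u^T *m A *m v) 0 0.

Lemma bilDl A u v w : bil A (u + v) w = bil A u w + bil A v w.
Proof. by rewrite /bil linearD /= !mulmxDl mxE. Qed.

Lemma bilDr A u v w : bil A u (v + w) = bil A u v + bil A u w.
Proof. by rewrite /bil mulmxDr mxE. Qed.

Lemma bilZl A a u v : bil A (a *: u) v = a * bil A u v.
Proof. by rewrite /bil linearZ /= -!scalemxAl mxE. Qed.

Lemma bilZr A a u v : bil A u (a *: v) = a * bil A u v.
Proof. by rewrite /bil -scalemxAr mxE. Qed.

Lemma bil_sym A u v : A^T = A -> bil A u v = bil A v u.
Proof.
move=> sA; rewrite /bil -[in LHS](trmxK (u^T *m A *m v)) mxE.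
by rewrite !trmx_mul trmxK sA mulmxA.
Qed.

Lemma bil_mulmx A g u v : bil A (g *m u) (g *m v) = bil (g^T *m A *m g) u v.
Proof. by rewrite /bil trmx_mul !mulmxA. Qed.

Lemma bil_delta A i j : bil A (delta_mx i 0) (delta_mx j 0) = A i j.
Proof.
by rewrite /bil trmx_delta -rowE -colE !mxE.
Qed.

Lemma bil_inj A B : (forall u v, bil A u v = bil B u v) -> A = B.
Proof. by move=> AB; apply/matrixP => i j; rewrite -!bil_delta AB. Qed.

End BilinearForm.

(** Polarization at [u + v], as 2 is invertible. *)
Lemma sym_form_inj (R : realFieldType) n (A B : 'M[R]_n) :
  A^T = A -> B^T = B -> (forall w, bil A w w = bil B w w) -> A = B.
Proof.
move=> sA sB AB; apply: bil_inj => u v.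
have := AB (u + v); rewrite !(bilDl, bilDr) !AB.
rewrite (bil_sym v u sA) (bil_sym v u sB); lra.
Qed.

(** * The Lorentz form and its positive vectors *)

Section Lorentz.
Context {R : realType} {n : nat}.
Local Notation J := (@lorentz R n).
Implicit Types (u v w x e : 'cV[R]_n.+1).

Lemma lorentz_tr : J^T = J. Proof. exact: tr_diag_mx. Qed.

Lemma lorentz_bilC u v : bil J u v = bil J v u.
Proof. by rewrite bil_sym ?lorentz_tr. Qed.

Lemma lorentz_sq : J *m J = 1%:M.
Proof.
rewrite /lorentz mulmx_diag -diag_const_mx; congr diag_mx.
by apply/rowP => i; rewrite !mxE; case: ifP; rewrite ?mulrNN mulr1.
Qed.

Lemma lorentz_mulE v i : (J *m v) i 0 = (if i == ord_max then -1 else 1) * v i 0.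
Proof. by rewrite mul_diag_mx !mxE. Qed.

Lemma sum_sqr_gt0 v : v != 0 -> 0 < \sum_i v i 0 ^+ 2.
Proof.
move=> v0; rewrite lt_def sumr_ge0 ?andbT => [|i _]; last exact: sqr_ge0.
apply: contra v0 => /eqP /psumr_eq0P v0; apply/eqP/colP => i; rewrite mxE.
by apply/eqP; rewrite -sqrf_eq0; apply/eqP/v0 => // j _; exact: sqr_ge0.
Qed.

Lemma lorentz_gt0 x : x ord_max 0 = 0 -> x != 0 -> 0 < bil J x x.
Proof.
move=> xn x0.
have -> : bil J x x = \sum_i x i 0 ^+ 2.
  rewrite /bil -mulmxA mxE; apply: eq_bigr => i _; rewrite lorentz_mulE !mxE.
  by case: eqP => [->|_]; rewrite ?xn ?expr2 ?mul0r ?mulr0 ?mul1r.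
exact: sum_sqr_gt0.
Qed.

(** As [J] squares to the identity, this number is the squared Euclidean norm of [e]. *)
Lemma bil_lorentz_gt0 e : e != 0 -> 0 < bil J e (J *m e).
Proof.
move=> e0; have -> : bil J e (J *m e) = \sum_i e i 0 ^+ 2.
  rewrite /bil mulmxA -(mulmxA _ J J) lorentz_sq mulmx1 mxE.
  by apply: eq_bigr => i _; rewrite mxE.
exact: sum_sqr_gt0.
Qed.

(** * The plane spanned by a null vector [e] and its mirror image [J *m e] *)

Section Null.
Variables (e : 'cV[R]_n.+1) (e0 : e != 0) (e_null : bil J e e = 0).
Local Notation f := (J *m e).
Local Notation N := (bil J e f).

Lemma null_opp : bil J f f = 0.
Proof. by rewrite bil_mulmx lorentz_tr -mulmxA lorentz_sq mulmx1. Qed.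

(** [e - f] is a nonzero multiple of the last basis vector, so [x] has last coordinate zero, where
    the form is Euclidean. *)
Lemma transverse_gt0 x :
  bil J e x = 0 -> bil J f x = 0 -> x != 0 -> 0 < bil J x x.
Proof.
move=> ex fx; apply: lorentz_gt0.
have en : e ord_max 0 != 0.
  apply: contraTneq e0 => en; rewrite negbK; apply: contraPT e_null.
  by move=> /(lorentz_gt0 en); lra.
have : bil J (e - f) x = 0 by rewrite -scaleN1r bilDl bilZl ex fx; lra.
have -> : e - f = (2 * e ord_max 0) *: delta_mx ord_max 0.
  apply/colP => i; rewrite [LHS]mxE [X in _ + X]mxE lorentz_mulE !mxE andbT.
  by case: eqP => [->|_] /=; lra.
rewrite bilZl /bil trmx_delta -mulmxA -rowE mxE lorentz_mulE eqxx.
by move/eqP; rewrite !mulf_eq0 (negPf en) pnatr_eq0 oppr_eq0 oner_eq0 /= => /eqP.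
Qed.

(** [e] and [f] are null and their pairing [N] is nonzero, so each coefficient is read off by
    pairing with the other vector. *)
Lemma null_decomp w : exists x,
  [/\ bil J e x = 0, bil J f x = 0 &
   w = (bil J f w / N) *: e + x + (bil J e w / N) *: f].
Proof.
have N0 : N != 0 by rewrite gt_eqF // bil_lorentz_gt0.
have fe : bil J f e = N by rewrite lorentz_bilC.
exists (w + (- (bil J f w / N)) *: e + (- (bil J e w / N)) *: f); split.
- by rewrite !(bilDr, bilZr) e_null; field.
- by rewrite !(bilDr, bilZr) null_opp fe; field.
- by rewrite !scaleNr -[RHS]addrA subrK addrC subrK.
Qed.

(** The transverse component of [w] is null, hence zero by positivity. So on the light cone
    [bil J e] vanishes only along the line of [e]. *)
Lemma null_orthogonal w : bil J w w = 0 -> bil J e w = 0 ->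
  w = (bil J f w / N) *: e.
Proof.
move=> ww ew; have [x [ex fx wE]] := null_decomp w.
have xx : bil J x x = 0.
  move: ww; rewrite {1 2}wE ew !(bilDl, bilDr, bilZl, bilZr) e_null ex fx.
  rewrite (lorentz_bilC x e) ex; lra.
rewrite {1}wE ew mul0r scale0r addr0.
suff -> : x = 0 by rewrite addr0.
by apply/eqP; apply: contra_eqT xx => /(transverse_gt0 ex fx) /gt_eqF ->.
Qed.


(* Along the parabola [f + t x - t^2 (bil J x x / 2 N) e] of the light cone,
   [bil S] is a bounded polynomial in [t], hence constant. *)
Lemma bounded_parabola (S : 'M[R]_n.+1) (m : R) (x : 'cV[R]_n.+1) :
  S^T = S ->
  (forall w, bil J w w = 0 -> bil J e w != 0 ->
    `|bil S w w| <= m * bil J e w ^+ 2) ->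
  bil J e x = 0 -> bil J f x = 0 ->
  [/\ bil J x x ^+ 2 * bil S e e = 0, bil J x x * bil S e x = 0,
      bil S x x = bil S e f / N * bil J x x & bil S x f = 0].
Proof.
move=> sS mS ex fx; have N_gt0 := bil_lorentz_gt0 e0; set q := bil J x x.
pose c4 := (q / (2 * N)) ^+ 2 * bil S e e; pose c3 := - (q / N) * bil S e x.
pose c2 := bil S x x - bil S e f / N * q; pose c1 := 2 * bil S x f.
pose c0 := bil S f f.
pose p := \poly_(i < 5) [:: c0; c1; c2; c3; c4]`_i.
have pE t : p.[t] = c0 + c1 * t + c2 * t ^+ 2 + c3 * t ^+ 3 + c4 * t ^+ 4.
  by rewrite horner_poly !big_ord_recr big_ord0 /= expr0 expr1 mulr1 add0r.
have /bounded_poly_const pC : forall t, 1 <= t -> `|p.[t]| <= m * N ^+ 2.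
  (* The [e] term cancels [t ^+ 2 * q] and makes [w] null, while [bil J e w] remains [N]. *)
  move=> t _; pose w := f + t *: x + (- (t ^+ 2 * (q / (2 * N)))) *: e.
  have ew : bil J e w = N by rewrite !(bilDr, bilZr) ex e_null; ring.
  have -> : p.[t] = bil S w w.
    rewrite pE /c0 /c1 /c2 /c3 /c4 !(bilDl, bilDr, bilZl, bilZr).
    rewrite (bil_sym x e) // (bil_sym f e) // (bil_sym f x) //.
    by field; rewrite gt_eqF.
  rewrite -ew; apply: mS; last by rewrite ew gt_eqF.
  rewrite !(bilDl, bilDr, bilZl, bilZr) null_opp e_null.
  rewrite (lorentz_bilC x e) (lorentz_bilC f e) (lorentz_bilC x f) ex fx -/q.
  by field; rewrite gt_eqF.
have pk k : (0 < k < 5)%N -> [:: c0; c1; c2; c3; c4]`_k = 0.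
  case/andP=> k_gt0 k5; have := coef_poly 5 (fun i => [:: c0; c1; c2; c3; c4]`_i) k.
  by rewrite k5 => <-; rewrite -/p pC coefC gtn_eqF.
have /= h1 := pk 1%N isT; have /= h2 := pk 2%N isT.
have /= h3 := pk 3%N isT; have /= h4 := pk 4%N isT.
have NV0 : N^-1 != 0 by rewrite invr_eq0 gt_eqF.
split.
- have -> : q ^+ 2 * bil S e e = 4 * N ^+ 2 * c4 by rewrite /c4; field; rewrite gt_eqF.
  by rewrite h4 mulr0.
- have -> : q * bil S e x = - N * c3 by rewrite /c3; field; rewrite gt_eqF.
  by rewrite h3 mulr0.
- by apply/eqP; rewrite -subr_eq0; apply/eqP.
- move: h1; rewrite /c1; lra.
Qed.

(** Compare both sides on [r e + x + s f]: the parabolas express every value of [S] through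
    [bil S e f] and [bil S f f]. *)
Lemma bounded_on_lightcone (S : 'M[R]_n.+1) (m : R) (x0 : 'cV[R]_n.+1) :
  S^T = S ->
  (forall w, bil J w w = 0 -> bil J e w != 0 ->
    `|bil S w w| <= m * bil J e w ^+ 2) ->
  x0 != 0 -> bil J e x0 = 0 -> bil J f x0 = 0 ->
  S = (bil S e f / N) *: J + (bil S f f / N ^+ 2) *: (f *m f^T).
Proof.
move=> sS mS x00 ex0 fx0; have N_gt0 := bil_lorentz_gt0 e0.
(* The nonzero [x0] has [bil J x0 x0] positive, so the quartic coefficient can vanish only in this
   way. *)
have See : bil S e e = 0.
  have [/eqP + _ _ _] := bounded_parabola sS mS ex0 fx0.
  by rewrite mulf_eq0 expf_eq0 /= gt_eqF ?transverse_gt0 // => /eqP.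
apply: sym_form_inj => // [|w].
  by rewrite linearD !linearZ /= trmx_mul trmxK lorentz_tr.
have ffE u v : bil (f *m f^T) u v = bil J e u * bil J e v.
  have -> : bil (f *m f^T) u v = ((u^T *m f) *m (f^T *m v)) 0 0.
    by rewrite /bil !mulmxA.
  rewrite mxE big_ord1 trmx_mul lorentz_tr (lorentz_bilC e u).
  by rewrite /bil mulmxA.
have bilMD (A B : 'M[R]_n.+1) u v : bil (A + B) u v = bil A u v + bil B u v.
  by rewrite /bil mulmxDr mulmxDl mxE.
have bilMZ a (A : 'M[R]_n.+1) u v : bil (a *: A) u v = a * bil A u v.
  by rewrite /bil -scalemxAr -scalemxAl mxE.
rewrite bilMD !bilMZ ffE.
have [x [ex fx ->]] := null_decomp w.
set r := _ / N; set s := bil J e w / N.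
have [_ qSex Sxx Sxf] := bounded_parabola sS mS ex fx.
have Sex : bil S e x = 0.
  have [->|x_neq0] := eqVneq x 0; first by rewrite /bil mulmx0 mxE.
  by move/eqP: qSex; rewrite mulf_eq0 gt_eqF ?transverse_gt0 // => /eqP.
rewrite !(bilDl, bilDr, bilZl, bilZr) null_opp e_null.
rewrite (bil_sym x e sS) (bil_sym f e sS) (bil_sym f x sS).
rewrite (lorentz_bilC x e) (lorentz_bilC f e) (lorentz_bilC x f).
by rewrite ex fx Sex Sxf See Sxx; field; rewrite gt_eqF.
Qed.

(** [x] and [e + f] span a positive definite plane; [h] sends some nonzero vector of it to last
    coordinate zero, where [J] is positive. *)
Lemma lorentz_factor_gt0 (h : 'M[R]_n.+1) (a : R) (x : 'cV[R]_n.+1) :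
  h \in unitmx -> h^T *m J *m h = a *: J ->
  x != 0 -> bil J e x = 0 -> bil J f x = 0 -> 0 < a.
Proof.
move=> hU hJ x_neq0 ex fx; have N_gt0 := bil_lorentz_gt0 e0.
have x_gt0 := transverse_gt0 ex fx x_neq0.
have hE u : bil J (h *m u) (h *m u) = a * bil J u u.
  by rewrite bil_mulmx hJ /bil -scalemxAr -scalemxAl mxE.
have gt0 u : (h *m u) ord_max 0 = 0 -> u != 0 -> 0 < a * bil J u u.
  move=> hu u0; rewrite -hE; apply: lorentz_gt0 => //.
  by apply: contra u0 => /eqP hu0; rewrite -(mulKmx hU u) hu0 mulmx0.
have [y yy xy] : exists2 y, bil J y y = 2 * N & bil J x y = 0.
  exists (e + f).
    by rewrite !(bilDl, bilDr) null_opp e_null (lorentz_bilC f e); ring.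
  by rewrite bilDr (lorentz_bilC x e) (lorentz_bilC x f) ex fx addr0.
(* Chosen so that [h *m c] has last coordinate zero. If [c] vanishes, pairing it with [y] shows that
   [x] already has this property. *)
pose c := (h *m y) ord_max 0 *: x + (- (h *m x) ord_max 0) *: y.
have [c0|c_neq0] := eqVneq c 0.
  have /eqP : bil J c y = 0 by rewrite c0 /bil trmx0 !mul0mx mxE.
  rewrite bilDl !bilZl xy yy mulr0 add0r mulf_eq0 oppr_eq0.
  rewrite mulf_eq0 pnatr_eq0 (gt_eqF N_gt0) !orbF => /eqP /gt0 /(_ x_neq0).
  by rewrite pmulr_lgt0.
have cc : 0 < bil J c c.
  set b := (h *m y) ord_max 0 in c c_neq0 *.
  set d := - (h *m x) ord_max 0 in c c_neq0 *.
  have -> : bil J c c = b ^+ 2 * bil J x x + d ^+ 2 * (2 * N).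
    by rewrite !(bilDl, bilDr, bilZl, bilZr) (lorentz_bilC y x) xy yy; ring.
  have bx : 0 <= b ^+ 2 * bil J x x by rewrite mulr_ge0 ?sqr_ge0 // ltW.
  have dN : 0 <= d ^+ 2 * (2 * N) by rewrite mulr_ge0 ?sqr_ge0 ?mulr_ge0 ?ler0n // ltW.
  rewrite lt_def addr_ge0 // andbT paddr_eq0 //; apply: contra c_neq0.
  rewrite !mulf_eq0 !orbb pnatr_eq0 (gt_eqF x_gt0) (gt_eqF N_gt0) !orbF.
  case/andP=> /eqP b0 /eqP d0.
  by rewrite /c b0 d0 !scale0r addr0.
have /gt0 /(_ c_neq0) : (h *m c) ord_max 0 = 0.
  by rewrite mulmxDr -!scalemxAr !mxE; ring.
by rewrite pmulr_lgt0.
Qed.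

End Null.
End Lorentz.

(** * Continuity, and boundedness from cocompactness *)

Lemma continuous_sum (R : realType) (T : topologicalType) (I : Type) (r : seq I)
    (F : I -> T -> R) :
  (forall i, continuous (F i)) -> continuous (fun v => \sum_(i <- r) F i v).
Proof.
by move=> cF v; apply: cvg_big => [|i _]; [exact: add_continuous | exact: cF].
Qed.

Lemma continuous_bil_r (R : realType) (n : nat) (S : 'M[R]_n) (u : 'cV[R]_n) :
  continuous (fun v : 'cV[R]_n => bil S u v).
Proof.
have -> : (fun v : 'cV[R]_n => bil S u v) =
    (fun v => \sum_j (u^T *m S) 0 j * v j 0).
  by apply/funext => w; rewrite /bil mxE.
apply: continuous_sum => j v; apply: continuousM; first exact: cst_continuous.
exact: coord_continuous.
Qed.

Lemma continuous_bil_diag (R : realType) (n : nat) (S : 'M[R]_n) :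
  continuous (fun v : 'cV[R]_n => bil S v v).
Proof.
have -> : (fun v : 'cV[R]_n => bil S v v) =
    (fun v => \sum_j v j 0 * bil S (delta_mx j 0) v).
  apply/funext => w; rewrite /bil -mulmxA mxE; apply: eq_bigr => j _.
  by rewrite trmx_delta -mulmxA -rowE !mxE.
apply: continuous_sum => j v; apply: continuousM; first exact: coord_continuous.
exact: continuous_bil_r.
Qed.

Section Boundedness.
Context {R : realType} {n : nat}.
Local Notation J := (@lorentz R n).
Implicit Types (S A : 'M[R]_n.+1) (e v w : nzvec R n) (x : RP R n).

(* The condition is homogeneous of degree 2 in the representative, so this
   is a subset of projective space. *)
Definition form_lt S e (k : R) x : Prop :=
  `|bil S (repr x) (repr x)| < k * bil J e (repr x) ^+ 2.

Lemma form_lt_pi S e k v :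
  form_lt S e k (\pi_(RP R n) v) <-> `|bil S v v| < k * bil J e v ^+ 2.
Proof.
have /RP_eqP[c c0 vE] : \pi_(RP R n) (repr (\pi_(RP R n) v)) = \pi_(RP R n) v.
  by rewrite reprK.
rewrite /form_lt vE !(bilZl, bilZr) mulrA normrM -expr2 exprMn.
have c2 : 0 < c ^+ 2 by rewrite exprn_even_gt0.
by rewrite ger0_norm ?(ltW c2) // mulrCA ltr_pM2l.
Qed.

Lemma open_form_lt S e k : open (form_lt S e k).
Proof.
rewrite /open /= /quotient_open.
have -> : \pi_(RP R n) @^-1` form_lt S e k =
    (@vec R n) @^-1` [set v | 0 < k * (bil J e v * bil J e v) - `|bil S v v|].
  apply/funext => v; apply/propext => /=; rewrite subr_gt0 -expr2.
  exact: form_lt_pi.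
apply: open_comp => [v _|]; first exact: initial_continuous.
set F := fun v : 'cV[R]_n.+1 => k * (bil J e v * bil J e v) - `|bil S v v|.
suff cF : continuous F.
  by apply: (@open_comp _ _ F [set y | 0 < y]) => [v _|]; [exact: cF | exact: open_gt].
have cJ := @continuous_bil_r R n.+1 J e.
have cM : continuous (fun v : 'cV[R]_n.+1 => k * (bil J e v * bil J e v)).
  by move=> v; exact: cvgM (cvg_cst k) (cvgM (cJ v) (cJ v)).
have cN : continuous (fun v : 'cV[R]_n.+1 => `|bil S v v|).
  by move=> v; exact: cvg_norm (@continuous_bil_diag R n.+1 S v).
by move=> v; exact: cvgB (cM v) (cN v).
Qed.

(** The open sets [form_lt S e k], increasing in [k], cover [K], so one of them contains it; the
    group preserves both sides and carries the bound from [K] to the rest of the light cone. *)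
Lemma cocompact_form_bounded (G : set (PGL R n)) e S :
  bil J e e = 0 -> cocompact_on G (hyp_boundary `\ \pi_(RP R n) e) ->
  (forall g, G g -> exists A : GL R n, [/\ \pi_(PGL R n) A = g,
     A^T *m S *m A = S & forall v : 'cV_n.+1, bil J e (A *m v) ^+ 2 = bil J e v ^+ 2]) ->
  exists m : R, forall w : 'cV[R]_n.+1, bil J w w = 0 -> bil J e w != 0 ->
    `|bil S w w| <= m * bil J e w ^+ 2.
Proof.
move=> e_null [K [cK KX XK]] GS.
have : \forall i \near \oo, K `<=` form_lt S e i%:R.
  move/compact_near_coveringP: cK; apply => x Kx.
  have [[v /= v_null vx] xe] := KX x Kx.
  (* A null [v] orthogonal to [e] would represent the excluded point. *)
  have ev : 0 < bil J e v ^+ 2.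
    rewrite exprn_even_gt0 //=; apply: contra_notN xe => /eqP ev /=.
    rewrite -vx; apply/RP_eqP; have /= vE := null_orthogonal (vec_neq0 e) e_null v_null ev.
    eexists; last exact: vE.
    by apply: contraTneq (vec_neq0 v) => c0; rewrite vE c0 scale0r eqxx.
  set r := `|bil S v v| / bil J e v ^+ 2.
  exists (form_lt S e (r + 1), [set i | (r + 1 <= i%:R)]).
    split=> /=; last exact: nbhs_infty_ger.
    apply: open_nbhs_nbhs; split; first exact: open_form_lt.
    rewrite -vx; apply/form_lt_pi.
    by rewrite mulrDl mul1r divfK ?gt_eqF // ltrDl.
  case=> y i [/= yr ri]; apply: lt_le_trans yr _.
  by rewrite ler_wpM2r // sqr_ge0.
case=> i _ /(_ i (leqnn i)) Ki; exists i%:R => w w_null ew.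
have w0 : w != 0 by apply: contraNneq ew => ->; rewrite /bil mulmx0 mxE.
have [|g Gg [x Kx gx]] := XK (\pi_(RP R n) (MkNzvec w0)).
  split; first by exists (MkNzvec w0).
  move=> /RP_eqP[c c0 /= wE].
  by move: ew; rewrite wE bilZr e_null mulr0 eqxx.
have [A [Ag AS AJ]] := GS g Gg.
have [[v /= v_null vx] _] := KX x Kx.
move: gx; rewrite -Ag -vx PGLact_pi => /RP_eqP[c c0 /= wE].
have := Ki x Kx; rewrite -vx => /form_lt_pi.
have SE u : bil S (A *m u) (A *m u) = bil S u u by rewrite bil_mulmx AS.
rewrite -SE -AJ wE !(bilZl, bilZr) mulrA normrM -expr2 exprMn.
have c2 : 0 < c ^+ 2 by rewrite exprn_even_gt0.
by rewrite ger0_norm ?(ltW c2) // mulrCA ltr_pM2l // => /ltW.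
Qed.

End Boundedness.

(** * Parabolic isometries, cusp groups and shears *)

Section Cusp.
Context {R : realType} {n : nat}.
Local Notation J := (@lorentz R n).
Implicit Types (A : GL R n) (e : nzvec R n) (G : set (PGL R n)).

Lemma lorentz_det2 (A : 'M[R]_n.+1) : A^T *m J *m A = J -> \det A ^+ 2 = 1.
Proof.
move=> AJ; have := congr1 determinant AJ; rewrite !det_mulmx det_tr => dA.
have J0 : \det J != 0.
  have := congr1 determinant (@lorentz_sq R n); rewrite det_mulmx det1.
  by move=> JJ; apply: contra_eq_neq JJ => ->; rewrite mul0r eq_sym oner_eq0.
by apply: (mulIf J0); rewrite mul1r -[RHS]dA; ring.
Qed.

Lemma lorentz_eigen_tr (A : 'M[R]_n.+1) (e : 'cV[R]_n.+1) (l : R) :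
  A^T *m J *m A = J -> A *m e = l *: e -> l *: (A^T *m (J *m e)) = J *m e.
Proof. by move=> AJ Ae; rewrite -[in RHS]AJ -!mulmxA Ae -!scalemxAr. Qed.

Lemma parabolic_fixed_uniq (g : PGL R n) (x y : RP R n) : parabolic g ->
  hyp_boundary x -> PGLact g x = x -> hyp_boundary y -> PGLact g y = y -> x = y.
Proof. by case=> _ [z [_ zu]] ? ? ? ?; rewrite -(zu x) // -(zu y). Qed.

Lemma PGLact_eigen A (v : nzvec R n) (l : R) :
  A *m v = l *: (v : 'cV_n.+1) -> PGLact (\pi_(PGL R n) A) (\pi_(RP R n) v) = \pi_(RP R n) v.
Proof.
move=> Av; rewrite PGLact_pi; apply/RP_eqP; exists l => //.
by apply: contraTneq (vec_neq0 (GLact A v)) => l0; rewrite /= Av l0 scale0r eqxx.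
Qed.

(* If [l] is an eigenvalue of an isometry then so is [l^-1], and an eigenvector
   for it is null unless [l ^ 2 = 1], giving a second fixed boundary point. *)
Lemma parabolic_eigenvalue A e (l : R) :
  (GLmx A)^T *m J *m A = J -> bil J e e = 0 -> A *m e = l *: (e : 'cV_n.+1) ->
  l != 0 -> parabolic (\pi_(PGL R n) A) -> l ^+ 2 = 1.
Proof.
move=> AJ e_null Ae l0 parA; apply/eqP/contraT => l2.
have JeA : ((J *m e)^T *m (GLmx A - l^-1%:M)) = 0.
  have /(congr1 trmx) := lorentz_eigen_tr AJ Ae.
  rewrite linearZ /= trmx_mul trmxK => fA.
  by rewrite mulmxBr mul_mx_scalar -[in X in _ - X]fA scalerA mulVf // scale1r subrr.
have /eqP : \det (GLmx A - l^-1%:M) = 0.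
  apply/eqP/det0P; exists (J *m e)^T => //.
  rewrite -trmx0 (inj_eq trmx_inj); apply: contra (vec_neq0 e) => /eqP Je.
  by rewrite -[vec e]mul1mx -lorentz_sq -mulmxA Je mulmx0.
rewrite -det_tr => /det0P[w w0 /(congr1 trmx)]; rewrite trmx_mul trmxK trmx0.
rewrite mulmxBl mul_scalar_mx => /eqP; rewrite subr_eq0 => /eqP Aw.
have wT0 : w^T != 0 by rewrite -trmx0 (inj_eq trmx_inj).
have w_null : bil J w^T w^T = 0.
  have := bil_mulmx J A w^T w^T; rewrite AJ Aw bilZl bilZr mulrA => /eqP.
  rewrite -subr_eq0 -[X in _ - X]mul1r -mulrBl mulf_eq0 => /orP[|/eqP //].
  by rewrite subr_eq0 -invfM invr_eq1 -expr2 (negPf l2).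
pose w' := MkNzvec wT0.
(* Uniqueness of the fixed point makes [e] and [w^T] proportional, so [l = l^-1], contrary to
   [l2]. *)
have : \pi_(RP R n) e = \pi_(RP R n) w'.
  apply: (parabolic_fixed_uniq parA).
  - by exists e.
  - exact: PGLact_eigen Ae.
  - by exists w'.
  - exact: PGLact_eigen (Aw : A *m w' = _).
move=> /RP_eqP[c c0 /= eE]; move/eqP: Ae.
rewrite {1}eE -scalemxAr Aw scalerA mulrC -scalerA -eE -subr_eq0 -scalerBl.
rewrite scaler_eq0 (negPf (vec_neq0 e)) orbF subr_eq0 => /eqP lV.
by move: l2; rewrite expr2 -{1}lV mulVf ?eqxx.
Qed.

(** Fixing the cusp point makes [e] an eigenvector of an isometric lift. A nontrivial element is
    parabolic; the trivial one lifts to a scalar preserving [J]. *)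
Lemma cusp_lift G e (g : PGL R n) :
  cusp_holonomy G (\pi_(RP R n) e) -> bil J e e = 0 -> G g ->
  exists A : GL R n, exists l : R, [/\ \pi_(PGL R n) A = g,
    (GLmx A)^T *m J *m A = J, A *m e = l *: (e : 'cV_n.+1) & l ^+ 2 = 1].
Proof.
move=> [[_ GPO _] _ _ Gpar [_ Gp]] e_null Gg.
have [A /= AJ Ag] := GPO g Gg; exists A.
have := Gp g Gg; rewrite -Ag PGLact_pi => /RP_eqP[l l0 /= Ae].
exists l; split=> //; have [g1|g1] := eqVneq g 1%g; last first.
  by apply: (parabolic_eigenvalue AJ e_null Ae l0); rewrite Ag; exact: Gpar.
move: g1; rewrite -Ag => /PGL_eqP[c c0 /= AE].
have lc : l = c.
  move/eqP: Ae; rewrite AE -scalemxAl mul1mx -subr_eq0 -scalerBl scaler_eq0.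
  by rewrite (negPf (vec_neq0 e)) orbF subr_eq0 => /eqP.
move/eqP: AJ; rewrite AE scalemx1 tr_scalar_mx mul_scalar_mx mul_mx_scalar.
rewrite scalerA -subr_eq0 -{2}[J]scale1r -scalerBl scaler_eq0 => /orP[|/eqP J0].
  by rewrite subr_eq0 -expr2 -lc => /eqP.
case/negP: (oner_neq0 'M[R]_n.+1); apply/eqP; transitivity (J *m J).
  by rewrite lorentz_sq.
by rewrite J0 mulmx0.
Qed.

(** Such an [x] forces dimension at least two. It is the transverse part of [A *m (J *m e)] for a
    nontrivial element: were it zero, this null image would lie on the line of [e] or of
    [J *m e]. *)
Lemma cusp_transverse G e :
  cusp_holonomy G (\pi_(RP R n) e) -> bil J e e = 0 ->
  exists x : 'cV[R]_n.+1, [/\ x != 0, bil J e x = 0 & bil J (J *m e) x = 0].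
Proof.
move=> cG e_null; have [[_ _ Ginf] _ _ Gpar [pb _]] := cG.
have N_gt0 := bil_lorentz_gt0 (vec_neq0 e).
have [g Gg g1] : exists2 g, G g & g != 1%g.
  apply: contrapT => G1; apply: Ginf; apply: (sub_finite_set _ (finite_set1 1%g)).
  by move=> g Gg /=; apply: contrapT => /eqP g1; apply: G1; exists g.
have [A [l [Ag AJ Ae l2]]] := cusp_lift cG e_null Gg.
have f_not_e c : J *m e <> c *: (vec e).
  by move=> fe; move: N_gt0; rewrite fe bilZr e_null mulr0 ltxx.
have [x [ex fx AfE]] := null_decomp (vec_neq0 e) e_null (A *m (J *m e)).
exists x; split=> //; apply/eqP => x0.
move: AfE; rewrite x0 addr0; set u := _ / _; set v := _ / _ => AfE; clearbody u v.
have Af_null : bil J (A *m (J *m e)) (A *m (J *m e)) = 0.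
  by rewrite bil_mulmx AJ null_opp.
have /eqP : 2 * (u * v) * bil J e (J *m e) = 0.
  rewrite -[RHS]Af_null AfE !(bilDl, bilDr, bilZl, bilZr) null_opp // e_null.
  by rewrite (lorentz_bilC (J *m e) e); ring.
rewrite mulf_eq0 (gt_eqF N_gt0) orbF mulf_eq0 pnatr_eq0 /= mulf_eq0.
(* On the line of [J *m e] there would be a second fixed boundary point; on the line of [e], [A]
   would not be injective. *)
case/orP => [/eqP u0|/eqP v0].
  have f0 : J *m e != 0 by apply/eqP => f0; apply: (f_not_e 0); rewrite scale0r.
  have /RP_eqP[c _ /= fE] : \pi_(RP R n) (MkNzvec f0) = \pi_(RP R n) e.
    apply: (parabolic_fixed_uniq (Gpar g Gg g1)).
    - by exists (MkNzvec f0) => //; exact: null_opp.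
    - by rewrite -Ag; apply: (@PGLact_eigen _ _ v); rewrite /= AfE u0 scale0r add0r.
    - by exists e.
    - by rewrite -Ag; apply: PGLact_eigen Ae.
  exact: (f_not_e c).
apply: (f_not_e (u * l)); apply: (can_inj (mulKmx (GLmx_unit A))).
by rewrite AfE v0 scale0r addr0 -scalemxAr Ae scalerA -mulrA -expr2 l2 mulr1.
Qed.

(* Taking determinants, [c] is [1] or [-1]. *)
Lemma conj_pullback_invariant (B A A2 : 'M[R]_n.+1) (c : R) :
  B \in unitmx -> A^T *m J *m A = J -> A2^T *m J *m A2 = J ->
  A2 = c *: (invmx B *m (A *m B)) ->
  A^T *m ((invmx B)^T *m J *m invmx B) *m A = (invmx B)^T *m J *m invmx B.
Proof.
move=> BU AJ A2J A2E; set C := invmx B *m (A *m B) in A2E *.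
have CA : C *m invmx B = invmx B *m A by rewrite /C mulmxA mulmxK.
have c2 : c ^+ 2 = 1.
  have dC : \det C = \det A.
    by rewrite /C !det_mulmx det_inv mulrCA mulVr -?unitmxE // mulr1.
  have /eqP := lorentz_det2 A2J.
  rewrite A2E detZ exprMn dC (lorentz_det2 AJ) mulr1 exprAC.
  by rewrite pexpr_eq1 ?sqr_ge0 // => /eqP.
have CJ : C^T *m J *m C = J.
  rewrite -[RHS]A2J A2E [(_ *: _)^T]linearZ /= -!scalemxAl -!scalemxAr scalerA -expr2 c2.
  by rewrite scale1r.
have -> : A^T *m ((invmx B)^T *m J *m invmx B) *m A =
    (invmx B *m A)^T *m J *m (invmx B *m A) by rewrite trmx_mul !mulmxA.
by rewrite -CA trmx_mul -[in RHS]CJ !mulmxA.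
Qed.

(** [s] is the map [w |-> w + t J(e,w) e]: the two cross terms each give [t J(e,w)^2], and the term
    in [t^2] vanishes with [J(e,e)]. *)
Lemma shear_pullback (e : 'cV[R]_n.+1) (t : R) : bil J e e = 0 ->
  let s := 1%:M + t *: (e *m (J *m e)^T) in
  s^T *m J *m s = J + (2 * t) *: ((J *m e) *m (J *m e)^T).
Proof.
move=> e_null s; set f := J *m e.
have eJ : e^T *m J = f^T by rewrite trmx_mul lorentz_tr.
have fe : f^T *m e = 0.
  by rewrite -eJ; apply/matrixP => i j; rewrite !ord1 [RHS]mxE; exact: e_null.
have sJ : s^T *m J = J + t *: (f *m f^T).
  rewrite /s [(_ + _)^T]linearD /= [(_ *: _)^T]linearZ /= trmx1 trmx_mul trmxK.
  by rewrite mulmxDl mul1mx -scalemxAl -mulmxA eJ.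
rewrite sJ /s mulmxDr mulmx1 -scalemxAr mulmxDl (mulmxA J).
rewrite -scalemxAl -(mulmxA f) (mulmxA f^T) fe mul0mx mulmx0 scaler0 addr0.
by rewrite -addrA -scalerDl; congr (_ + _ *: _); ring.
Qed.

(** [A] multiplies [e] by [l] on the left and [(J *m e)^T] by [l^-1 = l] on the right, so it
    commutes with their product. *)
Lemma lorentz_shear_comm (A : 'M[R]_n.+1) (e : 'cV[R]_n.+1) (l t : R) :
  A^T *m J *m A = J -> A *m e = l *: e -> l ^+ 2 = 1 ->
  let s := 1%:M + t *: (e *m (J *m e)^T) in A *m s = s *m A.
Proof.
move=> AJ Ae l2 s; have l0 : l != 0 by rewrite -sqrf_eq0 l2 oner_eq0.
have fA : (J *m e)^T *m A = l *: (J *m e)^T.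
  have /(congr1 trmx) := lorentz_eigen_tr AJ Ae.
  rewrite linearZ /= trmx_mul trmxK => fA.
  by rewrite -[in RHS]fA scalerA -expr2 l2 scale1r.
rewrite /s mulmxDr mulmxDl mulmx1 mul1mx -scalemxAr -scalemxAl mulmxA Ae.
by rewrite -mulmxA fA -scalemxAl -scalemxAr.
Qed.

(** * From a projective conjugation to a hyperbolic one *)

Lemma conjugate_in_PGL_PO (G G2 : set (PGL R n)) (e : nzvec R n) :
  cusp_holonomy G (\pi_(RP R n) e) -> bil J e e = 0 ->
  maximal_rank G (\pi_(RP R n) e) -> G2 `<=` PO R n ->
  conjugate_in [set: PGL R n] G G2 -> conjugate_in (PO R n) G G2.
Proof.
move=> cG e_null mG PO2 [g _]; elim/quotW: g => B gG.
have BU := GLmx_unit B.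
pose S := (invmx B)^T *m J *m invmx B.
have SB : B^T *m S *m B = J.
  by rewrite /S !mulmxA -trmx_mul mulVmx // trmx1 mul1mx mulmxKV.
have sS : S^T = S by rewrite /S !trmx_mul trmxK lorentz_tr mulmxA.
have [x0 [x0_neq0 ex0 fx0]] := cusp_transverse cG e_null.
have [m mS] : exists m : R, forall w : 'cV[R]_n.+1, bil J w w = 0 ->
    bil J e w != 0 -> `|bil S w w| <= m * bil J e w ^+ 2.
  apply: (cocompact_form_bounded e_null mG) => h Gh.
  have [A [l [Ah AJ Ae l2]]] := cusp_lift cG e_null Gh.
  exists A; split=> // [|v].
    (* The conjugate lies in [PO], so it has an isometric lift [A2], a multiple of [B^-1 A B]. *)
    have : G2 (h ^ \pi_(PGL R n) B)%g by rewrite -gG; exists h.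
    move=> /PO2[A2 /= A2J].
    have -> : (h ^ \pi_(PGL R n) B)%g = \pi_(PGL R n) (B^-1 * (A * B))%g.
      by rewrite -Ah -PGLmul_pi -PGLmul_pi -PGLinv_pi.
    move=> /PGL_eqP[c c0 /= A2E].
    exact: conj_pullback_invariant BU AJ A2J A2E.
  have := bil_mulmx J A e v; rewrite AJ Ae bilZl => <-.
  by rewrite exprMn l2 mul1r.
have SE := bounded_on_lightcone (vec_neq0 e) e_null sS mS x0_neq0 ex0 fx0.
set a := bil S e (J *m e) / _ in SE; set c := bil S _ _ / _ in SE.
(* Otherwise the invertible [S] would be a multiple of [f f^T], where [f = J *m e], and would kill
   [x0]. *)
have a0 : a != 0.
  apply: contra x0_neq0 => /eqP a0.
  have SU : S \in unitmx.
    have : J \in unitmx by have [] := mulmx1_unit (@lorentz_sq R n).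
    by rewrite -SB !unitmx_mul => /andP[/andP[]].
  have fx : (J *m e)^T *m x0 = 0.
    by apply/matrixP => i j; rewrite !ord1 trmx_mul lorentz_tr [RHS]mxE; exact: ex0.
  have Sx0 : S *m x0 = 0.
    by rewrite SE a0 scale0r add0r -scalemxAl -(mulmxA (J *m e)) fx mulmx0 scaler0.
  by rewrite -(mulKmx SU x0) Sx0 mulmx0.
(* Makes the coefficient [2 * t] of the pulled back form equal to [c / a], as in [a^-1 *: S]. *)
pose t := c / (2 * a).
pose s := 1%:M + t *: (e *m (J *m e)^T) : 'M[R]_n.+1.
have sJ : s^T *m J *m s = a^-1 *: S.
  rewrite shear_pullback // SE scalerDr !scalerA mulVf // scale1r.
  by congr (_ + _ *: _); rewrite /t; field.
have sBJ : (s *m B)^T *m J *m (s *m B) = a^-1 *: J.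
  rewrite trmx_mul -SB.
  have -> : B^T *m s^T *m (B^T *m S *m B) *m (s *m B) =
    B^T *m (s^T *m J *m s) *m B by rewrite SB !mulmxA.
  by rewrite sJ -scalemxAr -scalemxAl.
have sU : s \in unitmx.
  have : s^T *m J *m s \in unitmx.
    by rewrite sJ unitmxZ ?unitfE ?invr_eq0 // /S !unitmx_mul unitmx_tr unitmx_inv BU
      (mulmx1_unit (@lorentz_sq R n)).1.
  by rewrite unitmx_mul => /andP[].
have a_gt0 : 0 < a.
  rewrite -invr_gt0; apply: (lorentz_factor_gt0 (vec_neq0 e) e_null _ sBJ) ex0 fx0 => //.
  by rewrite unitmx_mul sU.
(* [s *m B] scales [J] by [a^-1]; the square root corrects this within the same projective class. *)
have kU : Num.sqrt a *: (s *m B) \in unitmx.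
  by rewrite unitmxZ ?unitfE ?sqrtr_eq0 -?ltNge // unitmx_mul sU.
pose k := MkGL kU.
have kE : \pi_(PGL R n) k = (\pi_(PGL R n) (MkGL sU) * \pi_(PGL R n) B)%g.
  rewrite -[RHS]/(PGLmul _ _) PGLmul_pi; apply/PGL_eqP.
  by exists (Num.sqrt a); rewrite // sqrtr_eq0 -ltNge.
exists (\pi_(PGL R n) k).
  exists k => //=; rewrite [(_ *: _)^T]linearZ /= -!scalemxAl -scalemxAr scalerA sBJ scalerA.
  by rewrite -expr2 sqr_sqrtr ?ltW // mulfV // scale1r.
(* Conjugation by [s] fixes each [h], which leaves conjugation by [B]. *)
rewrite -gG; apply: eq_imagel => h Gh; rewrite kE conjgM; congr (_ ^ _)%g.
have [A [l [<- AJ Ae l2]]] := cusp_lift cG e_null Gh.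
rewrite conjgE -[X in (_ * X)%g]/(PGLmul _ _) PGLmul_pi.
have -> : (A * MkGL sU)%g = (MkGL sU * A)%g.
  by apply: val_inj => /=; exact: lorentz_shear_comm AJ Ae l2.
by rewrite -PGLmul_pi; exact: (mulKg (\pi_(PGL R n) (MkGL sU))).
Qed.

End Cusp.

Theorem theorem0p7 (R : realType) (n : nat)
    (Gamma1 Gamma2 : set (PGL R n)) (p1 p2 : RP R n)
    (cusp1 : cusp_holonomy Gamma1 p1) (max1 : maximal_rank Gamma1 p1)
    (cusp2 : cusp_holonomy Gamma2 p2) (max2 : maximal_rank Gamma2 p2) :
  conjugate_in [set: PGL R n] Gamma1 Gamma2 <->
  conjugate_in (PO R n) Gamma1 Gamma2.
Proof.
split=> [|[g _ gG]]; last by exists g.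
have [_ _ _ _ [[e e_null pe] _]] := cusp1; have [[_ PO2 _] _ _ _ _] := cusp2.
by apply: conjugate_in_PGL_PO e_null _ PO2; rewrite pe.
Qed.
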